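(* Let $G$ be a finite connected bipartite planar graph with edges weighted by elements of a commutative ring $R$ with unit. Then all of the Kasteleyn-Percus matrices $M$ of $G$ are stably equivalent forms of each other over $R$. In particular, $\operatorname{coker} M$ is, up to isomorphism, an invariant of $G$ (that is, it does not depend on the choice of Kasteleyn-Percus matrix $M$ of $G$).
   Context: A planar graph is a graph embedded in the sphere $S^2$ with one marked point of $S^2$ off the graph; the face containing it is the infinite face and the others are the finite faces. The embedding, the marked point, and the coloring of the vertices as black and white are regarded as part of the data of $G$. Multiple edges are allowed. Kasteleyn-Percus matrix: assign a sign $+$ or $-$ to each edge of $G$ so that the boundary of each finite face has an odd number of $-$ signs if and only if its number of sides is divisible by $4$ (edges counted with multiplicity along the face boundary). The corresponding Kasteleyn-Percus matrix $M$ has rows indexed by the black vertices, columns indexed by the white vertices (in any order), and $M_{i,j}$ is the sum, over all edges joining black vertex $i$ to white vertex $j$, of the sign of the edge times its weight. Stable equivalence: matrices over $R$ (not necessarily square) are considered up to general row operations $M\mapsto AM$ and general column operations $M\mapsto MA$ with $A$ invertible over $R$, and stabilization $M\mapsto \begin{pmatrix}1&0\\0&M\end{pmatrix}$ and its inverse. A matrix obtained from $M$ by a sequence of these operations is a stably equivalent form of $M$. An $n\times k$ matrix $M$ over $R$ is viewed as a homomorphism $R^k\to R^n$, and $\operatorname{coker} M=R^n/\operatorname{im} M$. *)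

(* Defs.v *)
From HB Require Import structures.
From mathcomp Require Import all_boot all_fingroup all_algebra generic_quotient.
From mathcomp Require Import boolp.

Set Implicit Arguments.
Unset Strict Implicit.
Unset Printing Implicit Defensive.

Import GRing.Theory.
Local Open Scope ring_scope.

(* A finite graph (loops and multiple edges allowed) with a rotation system.
   Every edge e has the two darts (e, false) and (e, true), pointing in opposite
   directions; [origin d] is the vertex that the dart d leaves, and [rotation]
   sends d to the next dart leaving the same vertex in counterclockwise order. *)
Record rotation_system := RotationSystem {
  vertex : finType;
  edge : finType;
  origin : edge * bool -> vertex;
  rotation : {perm edge * bool};
  porbit_rotation :
    forall d, porbit rotation d = [set d' | origin d' == origin d]
}.

Definition dart (G : rotation_system) : finType := (edge G * bool)%type.

Definition flip_dart (G : rotation_system) (d : dart G) : dart G :=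
  (d.1, ~~ d.2).

Lemma flip_dartK (G : rotation_system) : involutive (@flip_dart G).
Proof. by case=> e b; rewrite /flip_dart /= negbK. Qed.

Definition flip (G : rotation_system) : {perm dart G} :=
  perm (inv_inj (@flip_dartK G)).

(* Follow a dart to its end and leave along the next dart there: this walks
   along the boundary of the face lying on the right of the dart. *)
Definition face_perm (G : rotation_system) : {perm dart G} :=
  (flip G * rotation G)%g.

(* A face of a connected graph is identified with the set of darts traversed by
   its boundary walk, so an edge with the same face on both sides contributes
   two darts to that face. A graph without edges (a single vertex) has one face,
   whose boundary has no sides. *)
Definition faces (G : rotation_system) : {set {set dart G}} :=
  if #|edge G| == 0%N then [set set0] else porbits (face_perm G).

Definition adjacent (G : rotation_system) : rel (vertex G) :=
  fun u v => [exists d : dart G, (origin d == u) && (origin (flip G d) == v)].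

(* A connected graph embedded in the sphere with a marked face: rotation systems
   of genus zero are exactly the connected graphs embedded in the sphere, up to
   orientation-preserving homeomorphism. *)
Record plane_graph := PlaneGraph {
  plane_map :> rotation_system;
  plane_connected : forall u v, connect (@adjacent plane_map) u v;
  plane_euler :
    (#|vertex plane_map| + #|faces plane_map| = #|edge plane_map| + 2)%N;
  infinite_face : {set dart plane_map};
  infinite_face_in : infinite_face \in faces plane_map
}.

Record bipartite_plane_graph := BipartitePlaneGraph {
  bip_graph :> plane_graph;
  black : pred (vertex bip_graph);
  bipartite :
    forall d : dart bip_graph,
      black (origin (flip bip_graph d)) = ~~ black (origin d)
}.

Section KasteleynPercus.

Variables (R : comPzRingType) (G : bipartite_plane_graph).

(* [neg e] means that the edge e carries the sign -. *)
Definition kasteleyn_signs (neg : pred (edge G)) : Prop :=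
  forall F : {set dart G}, F \in faces G -> F != infinite_face G ->
    odd #|[set d in F | neg d.1]| = (4 %| #|F|)%N.

Definition joins (e : edge G) (u v : vertex G) : bool :=
  [exists b : bool, (origin (e, b) == u) && (origin (e, ~~ b) == v)].

Definition enumerates (n : nat) (r : 'I_n -> vertex G) (A : pred (vertex G)) :
    Prop :=
  injective r /\ forall v, A v <-> exists i, r i = v.

Definition kasteleyn_percus (wt : edge G -> R) (n k : nat) (M : 'M[R]_(n, k)) :
    Prop :=
  exists (neg : pred (edge G)) (r : 'I_n -> vertex G) (c : 'I_k -> vertex G),
    [/\ kasteleyn_signs neg,
        enumerates r (@black G),
        enumerates c (predC (@black G)) &
        M = \matrix_(i < n, j < k)
              \sum_(e : edge G | joins e (r i) (c j)) (-1) ^+ neg e * wt e].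

End KasteleynPercus.

Section Matrices.

Variable R : comPzRingType.

(* [unitmx] would require decidable units and a nontrivial ring. *)
Definition invertible_mx (n : nat) (A : 'M[R]_n) : Prop :=
  exists B : 'M[R]_n, A *m B = 1%:M /\ B *m A = 1%:M.

Definition stabilization (n k : nat) (M : 'M[R]_(n, k)) :
    'M[R]_(1 + n, 1 + k) :=
  block_mx 1%:M 0 0 M.

Inductive stable_form (n k : nat) (M : 'M[R]_(n, k)) :
    forall n' k' : nat, 'M[R]_(n', k') -> Prop :=
| stable_refl : stable_form M M
| stable_row n' k' (N : 'M[R]_(n', k')) (A : 'M[R]_n') :
    stable_form M N -> invertible_mx A -> stable_form M (A *m N)
| stable_col n' k' (N : 'M[R]_(n', k')) (A : 'M[R]_k') :
    stable_form M N -> invertible_mx A -> stable_form M (N *m A)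
| stable_stab n' k' (N : 'M[R]_(n', k')) :
    stable_form M N -> stable_form M (stabilization N)
| stable_unstab n' k' (N : 'M[R]_(n', k')) :
    stable_form M (stabilization N) -> stable_form M N.

End Matrices.

Section Cokernel.

Variables (R : comPzRingType) (n k : nat) (M : 'M[R]_(n, k)).

(* The image of M acting on column vectors; membership is made boolean by
   excluded middle, as the library's quotients require. *)
Definition mximage : {pred 'cV[R]_n} :=
  fun v => `[< exists u : 'cV[R]_k, v = M *m u >].

Lemma mximage_zmod_closed : zmod_closed mximage.
Proof.
split=> [|_ _ /asboolP[u ->] /asboolP[v ->]].
  by apply/asboolP; exists 0; rewrite mulmx0.
by apply/asboolP; exists (u - v); rewrite mulmxBr.
Qed.

HB.instance Definition _ :=
  GRing.isZmodClosed.Build 'cV[R]_n mximage mximage_zmod_closed.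

Definition coker : Type := Quotient.quot mximage.

HB.instance Definition _ := GRing.Zmodule.on coker.

Local Open Scope quotient_scope.

Definition coker_proj (v : 'cV[R]_n) : coker :=
  \pi_(Quotient.quot mximage) v.

Definition coker_repr (x : coker) : 'cV[R]_n :=
  repr (x : Quotient.quot mximage).

Lemma coker_reprK x : coker_proj (coker_repr x) = x.
Proof. exact: reprK. Qed.

Lemma coker_projP u v :
  coker_proj u = coker_proj v <-> exists w : 'cV[R]_k, u - v = M *m w.
Proof.
have e : ((u - v) \in mximage) = (coker_proj u == coker_proj v).
  exact: (Quotient.idealrBE mximage).
split=> [/eqP|h]; first by rewrite -e => /asboolP.
by apply/eqP; rewrite -e; apply/asboolP.
Qed.

Lemma coker_projD : {morph coker_proj : u v / u + v}.
Proof. by move=> u v; rewrite /coker_proj raddfD. Qed.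

Definition coker_scale (a : R) (x : coker) : coker :=
  coker_proj (a *: coker_repr x).

Lemma coker_projZ a v : coker_proj (a *: v) = coker_scale a (coker_proj v).
Proof.
have /coker_projP[w e] := esym (coker_reprK (coker_proj v)).
by apply/coker_projP; exists (a *: w); rewrite -scalerBr e scalemxAr.
Qed.

Lemma coker_scaleA a b x : coker_scale a (coker_scale b x) = coker_scale (a * b) x.
Proof. by rewrite -(coker_reprK x) -!coker_projZ scalerA. Qed.

Lemma coker_scale1 : left_id 1 coker_scale.
Proof. by move=> x; rewrite -(coker_reprK x) -coker_projZ scale1r. Qed.

Lemma coker_scaleDr : right_distributive coker_scale +%R.
Proof.
move=> a x y; rewrite -(coker_reprK x) -(coker_reprK y).
by rewrite -coker_projD -!coker_projZ -coker_projD scalerDr.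
Qed.

Lemma coker_scaleDl x : {morph coker_scale^~ x : a b / a + b}.
Proof.
move=> a b; rewrite -(coker_reprK x).
by rewrite -!coker_projZ -coker_projD scalerDl.
Qed.

HB.instance Definition _ :=
  GRing.Zmodule_isLmodule.Build R coker
    coker_scaleA coker_scale1 coker_scaleDr coker_scaleDl.

End Cokernel.

Definition isomorphic_modules (R : comPzRingType) (U V : lmodType R) : Prop :=
  exists f : {linear U -> V}, bijective f.

(* Main.v *)
From HB Require Import structures.
Require Import Defs.
From mathcomp Require Import all_boot all_algebra.
From mathcomp Require Import all_fingroup boolp.

Set Implicit Arguments.
Unset Strict Implicit.
Unset Printing Implicit Defensive.

Import GRing.Theory.
Local Open Scope ring_scope.

(** Two Kasteleyn sign rules of a plane graph differ by a function t from edges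
    to F_2 whose sum around every finite face is zero. The sum over all darts
    counts each edge twice, hence vanishes, so the sum of t around the infinite
    face is zero too: t is a cocycle on the sphere. As H^1(S^2; F_2) = 0, it is
    the coboundary of a function s on vertices ([cocycle_coboundary]), which
    means that the second sign rule comes from the first by reversing the signs
    at the vertices where s = 1 ([kasteleyn_signs_gauge]).

    The vanishing of H^1 is a dimension count in the cochain complex
    F_2^V -> F_2^E -> F_2^F. The composite is zero. The kernel of the first map
    consists of constants because the graph is connected, and the kernel of the
    transpose of the second map consists of constants because the dual graph is
    connected ([dart_constant]). So the ranks are at least |V| - 1 and |F| - 1,
    and Euler's formula |V| + |F| = |E| + 2 forces exactness at F_2^E
    ([exact_of_euler]).

    Consequently two Kasteleyn-Percus matrices of the same graph have the same
    size, and one is obtained from the other by permuting the rows and columns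
    and multiplying them by signs ([kasteleyn_percus_equivalent]). Multiplication
    by invertible matrices on both sides is a stable equivalence, and it induces
    an isomorphism between the cokernels ([equivalent_mx_coker]). *)

(** * Exactness from an Euler characteristic *)

Section ExactSequence.

Variable K : fieldType.

Lemma rank_const_kernel m n (A : 'M[K]_(m, n)) :
  (forall u : 'rV_m, u *m A = 0 -> exists c, u = const_mx c) ->
  (m <= \rank A + 1)%N.
Proof.
move=> constA; suff: (\rank (kermx A) <= 1)%N.
  by rewrite mxrank_ker leq_subLR.
suff /mxrankS/leq_trans-> : (kermx A <= (const_mx 1 : 'rV[K]_m))%MS => //.
  exact: rank_leq_row.
apply/row_subP => i; have [|c ->] := constA (row i (kermx A)).
  by rewrite -row_mul mulmx_ker row0.
have -> : const_mx c = c *: const_mx 1 :> 'rV[K]_m.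
  by apply/rowP => j; rewrite !mxE mulr1.
exact: scalemx_sub.
Qed.

(** Matrices act on row vectors, so K^m -> K^n -> K^p is given by A and then B. *)
Lemma exact_of_euler m n p (A : 'M[K]_(m, n)) (B : 'M[K]_(n, p)) :
  A *m B = 0 ->
  (forall u : 'rV_m, u *m A = 0 -> exists c, u = const_mx c) ->
  (forall u : 'rV_p, u *m B^T = 0 -> exists c, u = const_mx c) ->
  (m + p = n + 2)%N ->
  forall u : 'rV_n, u *m B = 0 -> exists v, u = v *m A.
Proof.
move=> AB0 /rank_const_kernel rankA /rank_const_kernel rankB euler u uB0.
rewrite mxrank_tr in rankB.
have sAB : (A <= kermx B)%MS by apply/sub_kermxP.
suff sBA : (kermx B <= A)%MS.
  by apply/submxP/(submx_trans _ sBA)/sub_kermxP.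
rewrite -(geq_leqif (mxrank_leqif_sup sAB)) mxrank_ker leq_subLR.
rewrite -(leq_add2r 2) -euler [(_ + 2)%N](_ : _ = \rank A + 1 + (\rank B + 1))%N.
  exact: leq_add.
by rewrite addnACA [(\rank A + _)%N]addnC.
Qed.

End ExactSequence.

(** * Arithmetic modulo 2 *)

Lemma natr_F2 n : n%:R = (odd n)%:R :> 'F_2.
Proof.
by rewrite -[LHS](GRing.natr_mod_pchar (pchar_Fp (isT : prime 2))) modn2.
Qed.

Lemma addrr_F2 (x : 'F_2) : x + x = 0.
Proof. by rewrite -mulr2n -mulr_natr natr_F2 mulr0. Qed.

Lemma natr_addb_F2 (a b : bool) : (a (+) b)%:R = a%:R + b%:R :> 'F_2.
Proof. by apply/val_inj; case: a b => [] []. Qed.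

Lemma natr_bool_F2_inj (a b : bool) : a%:R = b%:R :> 'F_2 -> a = b.
Proof. by case: a b => [] []. Qed.

Lemma natr_neq0_F2 (x : 'F_2) : x = (x != 0)%:R.
Proof. by apply/val_inj; case: x => [[|[|]]]. Qed.

(** * Face boundaries of a rotation system *)

Section RotationSystem.

Variable G : rotation_system.

Lemma flipE (d : dart G) : flip G d = (d.1, ~~ d.2).
Proof. by rewrite permE. Qed.

Lemma flipK : involutive (flip G).
Proof. by move=> d; rewrite !flipE negbK; case: d. Qed.

Lemma origin_rotation (d : dart G) : origin (rotation G d) = origin d.
Proof.
have: rotation G d \in porbit (rotation G) d.
  by rewrite -{1}[rotation G]expg1 mem_porbit.
by rewrite porbit_rotation inE => /eqP.
Qed.

Lemma origin_face_perm (d : dart G) :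
  origin (face_perm G d) = origin (flip G d).
Proof. by rewrite /face_perm permM origin_rotation. Qed.

Lemma facesE : (0 < #|edge G|)%N -> faces G = porbits (face_perm G).
Proof. by rewrite /faces lt0n => /negPf->. Qed.

Lemma face_perm_face (F : {set dart G}) (d : dart G) :
  F \in porbits (face_perm G) -> (face_perm G d \in F) = (d \in F).
Proof.
case/imsetP=> x _ ->; have:= mem_porbit (face_perm G) 1 d; rewrite expg1.
by rewrite -!eq_porbit_mem => /eqP->.
Qed.

Lemma mem_faceE (F : {set dart G}) (d : dart G) :
  F \in porbits (face_perm G) -> (d \in F) = (F == porbit (face_perm G) d).
Proof. by case/imsetP=> x _ ->; rewrite -eq_porbit_mem eq_sym. Qed.

Lemma sum_dart_edge (A : zmodType) (F : pred (dart G)) (t : edge G -> A) :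
  \sum_(d | F d) t d.1 = \sum_e \sum_(b : bool) t e *+ F (e, b).
Proof.
rewrite pair_big /= big_mkcond; apply: eq_bigr => -[e b] _ /=.
by rewrite mulrb.
Qed.

Lemma sum_faces (A : zmodType) (t : dart G -> A) :
  \sum_(F in porbits (face_perm G)) \sum_(d in F) t d = \sum_d t d.
Proof.
rewrite (partition_big (porbit (face_perm G)) (mem (porbits (face_perm G)))) /=.
  apply: eq_bigr => F FP; apply: eq_bigl => d.
  by rewrite (mem_faceE _ FP) eq_sym.
by move=> d _; apply: imset_f.
Qed.

(** The coboundary of a function on vertices has zero sum around each face: the
    ends of the darts of a face are the origins of their successors. *)
Lemma sum_flip_face (A : zmodType) (s : vertex G -> A) (F : {set dart G}) :
  F \in porbits (face_perm G) ->
  \sum_(d in F) s (origin (flip G d)) = \sum_(d in F) s (origin d).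
Proof.
move=> FP; rewrite [RHS](reindex_inj (@perm_inj _ (face_perm G))) /=.
by apply: eq_big => d; rewrite ?origin_face_perm ?face_perm_face.
Qed.

Lemma sum_signs_F2 (neg : pred (edge G)) (F : {set dart G}) :
  \sum_(d in F) (neg d.1)%:R = (odd #|[set d in F | neg d.1]|)%:R :> 'F_2.
Proof.
rewrite -natr_F2 -sum1_card natr_sum [RHS]big_mkcond [LHS]big_mkcond /=.
by apply: eq_bigr => d _; rewrite inE; case: (d \in F); case: (neg d.1).
Qed.

End RotationSystem.

(** * First cohomology of the sphere modulo 2 *)

Section Cohomology.

Variable G : plane_graph.

(** H^0: a function on vertices that agrees at the ends of every edge is constant. *)
Lemma connected_constant (T : Type) (s : vertex G -> T) :
  (forall d : dart G, s (origin (flip G d)) = s (origin d)) ->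
  forall u v, s u = s v.
Proof.
move=> sE u v; have /connectP[p] := plane_connected u v.
elim: p u => [|w p IHp] u /=; first by move=> _ ->.
case/andP=> /existsP[d /andP[/eqP <- /eqP <-]] wp lp.
by rewrite -sE; apply: IHp.
Qed.

(** The dual graph is connected: a function on darts that is constant along
    faces and equal on the two sides of each edge is constant. Such a function
    is also invariant under the rotation, since the rotation is a flip followed
    by a step along a face; so it descends to vertices, and the connectedness of
    the graph itself applies. *)
Lemma dart_constant (T : Type) (g : dart G -> T) :
  (forall d, g (flip G d) = g d) -> (forall d, g (face_perm G d) = g d) ->
  forall d d', g d = g d'.
Proof.
move=> gflip gface d d'.
have grot x : g (rotation G x) = g x.
  by have := gface (flip G x); rewrite /face_perm permM flipK gflip.
have gvertex x y : origin x = origin y -> g x = g y.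
  move=> xy; have: y \in porbit (rotation G) x by rewrite porbit_rotation inE xy.
  case/porbitP=> i ->; rewrite permX.
  by elim: i => //= i ->; rewrite grot.
(* The property P of a vertex says that g takes the value g d' on all its darts. *)
pose P v := forall x, origin x = v -> g x = g d'.
have P0 : P (origin d') by move=> x /gvertex.
suff Pd : P (origin d) by apply: Pd.
rewrite (connected_constant (s := P) _ _ (origin d')) // => x.
apply/propext; split=> Px y yx.
  by rewrite (gvertex _ _ yx) -gflip; apply: Px.
by rewrite (gvertex _ _ yx) gflip; apply: Px.
Qed.

(** H^1 of the sphere vanishes: a function on edges with zero sum around every
    face is the coboundary of a function on vertices. *)
Lemma cocycle_coboundary (t : edge G -> 'F_2) :
  (0 < #|edge G|)%N ->
  (forall F, F \in faces G -> \sum_(d in F) t d.1 = 0) ->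
  exists s : vertex G -> 'F_2,
    forall e, t e = s (origin (e, false)) + s (origin (e, true)).
Proof.
move=> E_gt0 t_cocycle; have facesG := facesE E_gt0.
(* A and B are the coboundary maps from vertices to edges and from edges to
   faces, acting on row vectors. *)
pose A : 'M['F_2]_(#|vertex G|, #|edge G|) :=
  \matrix_(i, j)
    \sum_(b : bool) (origin (enum_val j : edge G, b) == enum_val i)%:R.
pose B : 'M['F_2]_(#|edge G|, #|faces G|) :=
  \matrix_(i, j)
    \sum_(b : bool) ((enum_val i : edge G, b) \in (enum_val j : {set dart G}))%:R.
(* A row vector read as a function on vertices, on edges, or on the faces (a
   face being given by one of its darts). *)
pose vtx (u : 'rV['F_2]_#|vertex G|) v : 'F_2 := u 0 (enum_rank v).
pose edg (u : 'rV['F_2]_#|edge G|) e : 'F_2 := u 0 (enum_rank e).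
have mem_faces d : porbit (face_perm G) d \in faces G.
  by rewrite facesG imset_f.
pose F0 := infinite_face_in G.
pose fce (u : 'rV['F_2]_#|faces G|) (d : dart G) : 'F_2 :=
  u 0 (enum_rank_in F0 (porbit (face_perm G) d)).
have mulA u e : edg (u *m A) e = \sum_b vtx u (origin (e, b)).
  rewrite /edg mxE; under eq_bigr do rewrite mxE mulr_sumr enum_rankK.
  rewrite exchange_big; apply: eq_bigr => b _ /=.
  rewrite (bigD1 (enum_rank (origin (e, b)))) //= enum_rankK eqxx mulr1.
  rewrite big1 ?addr0 // => i.
  case: (origin _ =P enum_val i) => [->|_ _]; last by rewrite mulr0.
  by rewrite enum_valK eqxx.
have mulB u j : (u *m B) 0 j = \sum_(d in enum_val j) edg u d.1.
  rewrite mxE (sum_dart_edge (mem (enum_val j)) (edg u)).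
  rewrite (reindex (@enum_rank (edge G))) /=; last first.
    by exists enum_val => i _; rewrite ?enum_valK ?enum_rankK.
  apply: eq_bigr => e _; rewrite mxE mulr_sumr enum_rankK.
  by apply: eq_bigr => b _; rewrite mulr_natr.
have mulBT u e : edg (u *m B^T) e = \sum_b fce u (e, b).
  rewrite /edg mxE; under eq_bigr do rewrite !mxE mulr_sumr enum_rankK.
  rewrite exchange_big; apply: eq_bigr => b _ /=.
  set j := enum_rank_in F0 (porbit (face_perm G) (e, b)).
  have facej (i : 'I_#|faces G|) :
      ((e, b) \in (enum_val i : {set dart G})) = (i == j).
    rewrite mem_faceE -?facesG ?enum_valP //.
    by rewrite -(inj_eq enum_val_inj) enum_rankK_in.
  rewrite (bigD1 j) //= facej eqxx mulr1 big1 ?addr0 // => i /negPf ij.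
  by rewrite facej ij mulr_natr.
have ext m (u v : 'rV['F_2]_m) : u 0 =1 v 0 -> u = v by move/rowP.
have add0 (x y : 'F_2) : x + y = 0 -> x = y.
  move/eqP; rewrite addr_eq0 => /eqP->.
  by rewrite -[LHS]addr0 -(addrr_F2 y) addKr.
have [|||||v tE] :=
  exact_of_euler (A := A) (B := B) _ _ _ _ (u := \row_j t (enum_val j)).
- apply/row_matrixP => i; rewrite row_mul row0; apply: ext => j.
  rewrite mulB mxE; pose s v : 'F_2 := (v == enum_val i)%:R.
  transitivity (\sum_(d in enum_val j) (s (origin (flip G d)) + s (origin d))).
    apply: eq_bigr => -[e b] _; rewrite flipE /edg !mxE enum_rankK big_bool /=.
    by case: b => //=; rewrite addrC.
  by rewrite big_split /= sum_flip_face ?addrr_F2 // -facesG enum_valP.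
- move=> u uA0; have vtx_flip d : vtx u (origin (flip G d)) = vtx u (origin d).
    have := mulA u d.1; rewrite uA0 /edg mxE big_bool flipE => /esym/add0.
    by case: d => e [].
  have vtx_const := connected_constant vtx_flip.
  case: (pickP (@predT (vertex G))) => [v _|V0].
    exists (vtx u v); apply: ext => i.
    by rewrite mxE (vtx_const v (enum_val i)) /vtx enum_valK.
  by exists 0; apply: ext => i; have := V0 (enum_val i).
- move=> u uB0; have fce_flip d : fce u (flip G d) = fce u d.
    have := mulBT u d.1; rewrite uB0 /edg mxE big_bool flipE => /esym/add0.
    by case: d => e [].
  have fce_face d : fce u (face_perm G d) = fce u d.
    by have := porbit_perm (face_perm G) 1 d; rewrite /fce expg1 => ->.
  have fce_const := dart_constant fce_flip fce_face.
  have /card_gt0P[e _] := E_gt0.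
  exists (fce u (e, true)); apply: ext => i; rewrite mxE.
  have: enum_val i \in porbits (face_perm G) by rewrite -facesG enum_valP.
  case/imsetP=> d _ id; rewrite (fce_const _ d) /fce; congr (u 0 _).
  by apply: enum_val_inj; rewrite enum_rankK_in.
- by have := plane_euler G.
- apply: ext => j; rewrite mulB mxE -[RHS](t_cocycle (enum_val j)) ?enum_valP //.
  by apply: eq_bigr => d _; rewrite /edg mxE enum_rankK.
exists (vtx v) => e; have := mulA v e; rewrite -tE /edg mxE enum_rankK => ->.
by rewrite big_bool addrC.
Qed.

End Cohomology.

(** * Change of Kasteleyn signs and of numberings *)

Section KasteleynSigns.

Variable G : bipartite_plane_graph.

(** Two Kasteleyn sign rules differ by reversing the signs of all the edges at
    some vertices; s is the set of these vertices. *)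
Lemma kasteleyn_signs_gauge (neg neg' : pred (edge G)) :
  kasteleyn_signs neg -> kasteleyn_signs neg' ->
  exists s : pred (vertex G), forall e,
    neg' e = neg e (+) (s (origin (e, false)) (+) s (origin (e, true))).
Proof.
move=> Kneg Kneg'; have [E_gt0|E0] := ltnP 0 #|edge G|; last first.
  exists predT => e; move: E0; rewrite leqNgt => /negP[].
  by apply/card_gt0P; exists e.
pose t e : 'F_2 := (neg e (+) neg' e)%:R.
have t_finite F : F \in faces G -> F != infinite_face G ->
    \sum_(d in F) t d.1 = 0.
  move=> FG Ffin; rewrite /t; under eq_bigr do rewrite natr_addb_F2.
  by rewrite big_split /= !sum_signs_F2 Kneg // Kneg' // addrr_F2.
have [F FG|s sE] := cocycle_coboundary (t := t) E_gt0.
  have [->|] := eqVneq F (infinite_face G); last exact: t_finite.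
  (* The infinite face: the sum over all faces counts every edge twice. *)
  have := sum_faces (fun d : dart G => t d.1).
  rewrite -facesE // (bigD1 (infinite_face G)) ?infinite_face_in //=.
  rewrite [X in _ + X]big1 ?addr0 => [->|F' /andP[F'G F'fin]]; last first.
    exact: t_finite.
  rewrite (sum_dart_edge predT t).
  by rewrite big1 // => e _; rewrite big_bool /= addrr_F2.
exists (fun v => s v != 0) => e; rewrite -[LHS](addKb (neg e)); congr addb.
by apply: natr_bool_F2_inj; rewrite [RHS]natr_addb_F2 -!natr_neq0_F2 -sE.
Qed.

Lemma joins_gauge (neg neg' : pred (edge G)) (s : pred (vertex G)) :
  (forall e,
    neg' e = neg e (+) (s (origin (e, false)) (+) s (origin (e, true)))) ->
  forall e u v, joins e u v -> neg' e = neg e (+) (s u (+) s v).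
Proof.
move=> sE e u v /existsP[[] /andP[/eqP<- /eqP<-]]; rewrite sE //.
by rewrite [s _ (+) _]addbC.
Qed.

Lemma enumerates_factor n n' (r : 'I_n -> vertex G) (r' : 'I_n' -> vertex G) A :
  enumerates r A -> enumerates r' A ->
  exists2 f : 'I_n' -> 'I_n, injective f & forall i, r' i = r (f i).
Proof.
move=> [_ rA] [r'_inj r'A].
have /choice[f fE] i : exists j, r j = r' i by apply/rA/r'A; exists i.
by exists f => // i j fij; apply: r'_inj; rewrite -!fE fij.
Qed.

Lemma enumerates_card n n' (r : 'I_n -> vertex G) (r' : 'I_n' -> vertex G) A :
  enumerates r A -> enumerates r' A -> n = n'.
Proof.
move=> rA r'A; apply/eqP; rewrite eqn_leq.
have [f /leq_card] := enumerates_factor r'A rA.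
have [g /leq_card] := enumerates_factor rA r'A.
by rewrite !card_ord => -> _ -> _.
Qed.

Lemma enumerates_perm n (r r' : 'I_n -> vertex G) A :
  enumerates r A -> enumerates r' A ->
  exists p : 'S_n, forall i, r' i = r (p i).
Proof.
move=> rA r'A; have [f f_inj fE] := enumerates_factor rA r'A.
by exists (perm f_inj) => i; rewrite permE.
Qed.

End KasteleynSigns.

(** * Equivalent matrices *)

Section Equivalence.

Variable R : comPzRingType.

Lemma invertible_mulmx n (A B : 'M[R]_n) :
  invertible_mx A -> invertible_mx B -> invertible_mx (A *m B).
Proof.
move=> [A' [AA' A'A]] [B' [BB' B'B]]; exists (B' *m A'); split.
  by rewrite mulmxA -(mulmxA A) BB' mulmx1.
by rewrite mulmxA -(mulmxA B') A'A mulmx1.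
Qed.

Lemma invertible_perm_mx n (p : 'S_n) : invertible_mx (perm_mx p : 'M[R]_n).
Proof. by exists (perm_mx p^-1); rewrite -!perm_mxM mulgV mulVg perm_mx1. Qed.

Lemma invertible_sign_mx n (s : 'I_n -> bool) :
  invertible_mx (diag_mx (\row_i (-1) ^+ s i) : 'M[R]_n).
Proof.
exists (diag_mx (\row_i (-1) ^+ s i)); rewrite mulmx_diag -diag_const_mx.
by split; congr diag_mx; apply/rowP => i; rewrite !mxE -signr_addb addbb.
Qed.

(** Equivalence of matrices of the same size, without stabilization. *)
Definition equivalent_mx n k (M N : 'M[R]_(n, k)) : Prop :=
  exists (A : 'M[R]_n) (B : 'M[R]_k),
    [/\ invertible_mx A, invertible_mx B & N = A *m M *m B].

Lemma equivalent_mx_stable_form n k (M N : 'M[R]_(n, k)) :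
  equivalent_mx M N -> stable_form M N.
Proof.
move=> [A [B [Ainv Binv ->]]].
by apply: stable_col => //; apply: stable_row => //; apply: stable_refl.
Qed.

Section CokerMap.

Variables (n k n' k' : nat) (M : 'M[R]_(n, k)) (M' : 'M[R]_(n', k')).
Variables (A : 'M[R]_(n', n)) (B : 'M[R]_(k', k)).

(** The map of cokernels induced by a commutative square: A sends the image of M
    into the image of M' because A *m M = M' *m B. *)
Definition coker_map of A *m M = M' *m B : coker M -> coker M' :=
  fun x => coker_proj M' (A *m coker_repr x).

Lemma coker_map_proj (AM : A *m M = M' *m B) v :
  coker_map AM (coker_proj M v) = coker_proj M' (A *m v).
Proof.
have /coker_projP[w e] := coker_reprK (coker_proj M v).
by apply/coker_projP; exists (B *m w); rewrite -mulmxBr e !mulmxA AM.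
Qed.

Fact coker_map_linear (AM : A *m M = M' *m B) : linear (coker_map AM).
Proof.
move=> a x y; rewrite -(coker_reprK x) -(coker_reprK y).
rewrite -[a *: _]coker_projZ -coker_projD !coker_map_proj.
by rewrite -[a *: _]coker_projZ -coker_projD mulmxDr scalemxAr.
Qed.

HB.instance Definition _ (AM : A *m M = M' *m B) :=
  GRing.isLinear.Build R (coker M) (coker M') *:%R (coker_map AM)
    (coker_map_linear AM).

End CokerMap.

Lemma equivalent_mx_coker n k (M N : 'M[R]_(n, k)) :
  equivalent_mx M N -> isomorphic_modules (coker M) (coker N).
Proof.
move=> [A [B [[A' [AA' A'A]] [B' [BB' B'B]] NE]]].
have AM : A *m M = N *m B' by rewrite NE -!mulmxA BB' mulmx1.
have A'N : A' *m N = M *m B by rewrite NE !mulmxA A'A mul1mx.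
exists (coker_map AM); exists (coker_map A'N) => x; rewrite -(coker_reprK x).
  by rewrite !coker_map_proj mulmxA A'A mul1mx !coker_reprK.
by rewrite /= !coker_map_proj mulmxA AA' mul1mx.
Qed.

(** * Kasteleyn-Percus matrices *)

Lemma kasteleyn_percus_size (G : bipartite_plane_graph) (wt : edge G -> R)
    n k n' k' (M : 'M[R]_(n, k)) (M' : 'M[R]_(n', k')) :
  kasteleyn_percus wt M -> kasteleyn_percus wt M' -> n = n' /\ k = k'.
Proof.
move=> [neg [r [c [_ rE cE _]]]] [neg' [r' [c' [_ r'E c'E _]]]].
by split; [apply: enumerates_card rE r'E | apply: enumerates_card cE c'E].
Qed.

Lemma kasteleyn_percus_equivalent (G : bipartite_plane_graph)
    (wt : edge G -> R) n k (M M' : 'M[R]_(n, k)) :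
  kasteleyn_percus wt M -> kasteleyn_percus wt M' -> equivalent_mx M M'.
Proof.
move=> [neg [r [c [Kneg rE cE ->]]]] [neg' [r' [c' [Kneg' r'E c'E ->]]]].
have [s /joins_gauge sE] := kasteleyn_signs_gauge Kneg Kneg'.
have [p pE] := enumerates_perm rE r'E; have [q qE] := enumerates_perm cE c'E.
exists (diag_mx (\row_i (-1) ^+ s (r' i)) *m perm_mx p).
exists (perm_mx q^-1 *m diag_mx (\row_j (-1) ^+ s (c' j))).
split.
- exact: invertible_mulmx (invertible_sign_mx _) (invertible_perm_mx _).
- exact: invertible_mulmx (invertible_perm_mx _) (invertible_sign_mx _).
rewrite mulmxA -(mulmxA _ (perm_mx p)) -row_permE -(mulmxA _ _ (perm_mx _)).
rewrite -col_permE mul_mx_diag mul_diag_mx; apply/matrixP => i j; rewrite !mxE.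
rewrite -pE -qE mulr_sumr mulr_suml; apply: eq_bigr => e ecc.
rewrite (sE _ _ _ ecc) !signr_addb mulrCA !mulrA.
by rewrite -!mulrA; congr (_ * (_ * _)); rewrite mulrC.
Qed.

End Equivalence.

Theorem proposition8 (R : comPzRingType) (G : bipartite_plane_graph)
    (wt : edge G -> R) (n k n' k' : nat)
    (M : 'M[R]_(n, k)) (M' : 'M[R]_(n', k')) :
  kasteleyn_percus wt M -> kasteleyn_percus wt M' ->
  stable_form M M' /\ isomorphic_modules (coker M) (coker M').
Proof.
move=> KM KM'; have [nE kE] := kasteleyn_percus_size KM KM'.
case: _ / nE kE M' KM' => kE; case: _ / kE => M' KM'.
have eqM := kasteleyn_percus_equivalent KM KM'.
by split; [apply: equivalent_mx_stable_form | apply: equivalent_mx_coker].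
Qed.
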